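(* Let $E=C_0([0,\pi];\mathbb R)$ carry classical Wiener measure $\mu$. If $f:E\to\mathbb R$ is continuous, locally real analytic, and not identically zero, then $$\mu\{B\in E:f(B)=0\}=0.$$
   Context: $C_0([0,\pi];\mathbb R)=\{B\in C([0,\pi];\mathbb R):B(0)=0\}$ with the uniform norm. Classical Wiener measure is the law on $E$ of standard Brownian motion on $[0,\pi]$ started at $0$. A function on a real Banach space is locally real analytic if near every point it is represented by a norm-convergent series of continuous homogeneous polynomials (in the increment). *)

(* Defs.v *)
From HB Require Import structures.
From mathcomp Require Import all_boot all_order all_algebra.
From mathcomp Require Import all_classical all_reals all_analysis.

Set Implicit Arguments.
Unset Strict Implicit.
Unset Printing Implicit Defensive.

Import Order.TTheory GRing.Theory Num.Theory.
Import numFieldNormedType.Exports.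

Local Open Scope classical_set_scope.
Local Open Scope ring_scope.

(* `set_type` carries the topology induced by R. *)
Notation time R := (set_type `[(0 : R), pi]%classic).

Lemma time0_subproof (R : realType) : (0 : R) \in `[0 : R, pi]%classic.
Proof. by rewrite inE/= in_itv/= lexx pi_ge0. Qed.

Definition time0 (R : realType) : time R := exist _ 0 (time0_subproof R).

Section C0.
Variable R : realType.

Definition C0_pred : {pred (time R -> R)} :=
  mem [set f : time R -> R | continuous f /\ f (time0 R) = 0].

Record C0 := mkC0 { C0_fun :> time R -> R ; C0_funP : C0_fun \in C0_pred }.

HB.instance Definition _ := [isSub for C0_fun].
HB.instance Definition _ := [Choice of C0 by <:].

Lemma C0_submod_closed : submod_closed C0_pred.
Proof.
split=> [|a f g]; first by rewrite inE/=; split=> // x; apply: cst_continuous.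
rewrite !inE/= => -[cf f0] [cg g0]; split.
  move=> x; apply: (@continuousD _ R^o) (cg x).
  by apply: (@continuousM _ _ (fun=> a)) (cf x); exact: cst_continuous.
by rewrite !fctE f0 g0 addr0 scaler0.
Qed.

HB.instance Definition _ := GRing.isSubmodClosed.Build _ _ C0_pred
  C0_submod_closed.
HB.instance Definition _ := [SubChoice_isSubLmodule of C0 by <:].

Definition C0_norm (f : C0) : R := sup (range (fun t => `|f t|)).

Lemma C0_has_sup (f : C0) : has_sup (range (fun t => `|f t|)).
Proof.
split; first by exists `|f (time0 R)|; exists (time0 R).
have /set_mem[cf _] := C0_funP f.
have cnf : continuous (fun t => `|f t|).
  by move=> t; apply: continuous_comp; [exact: cf|exact: norm_continuous].
move/subspace_valL_continuousP : cnf => /(EVT_max (pi_ge0 R))[c _ cmax].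
exists (valL (fun t => `|f t|) c) => _ [t _ <-].
have tI := set_valP t.
by have := cmax _ tI; rewrite -[X in X <= _ -> _]/(sigL _ (valL _) t) valLK.
Qed.

Lemma le_C0_norm (f : C0) t : `|f t| <= C0_norm f.
Proof. by apply: sup_upper_bound; [exact: C0_has_sup|exists t]. Qed.

Lemma C0_norm_le (f : C0) M : (forall t, `|f t| <= M) -> C0_norm f <= M.
Proof.
move=> fM; apply: ge_sup; first by have [] := C0_has_sup f.
by move=> _ [t _ <-].
Qed.

Lemma C0_ler_normD (f g : C0) : C0_norm (f + g) <= C0_norm f + C0_norm g.
Proof.
apply: C0_norm_le => t; apply: (le_trans (ler_normD _ _)).
by apply: lerD; exact: le_C0_norm.
Qed.

Lemma C0_normrZ (a : R) (f : C0) : C0_norm (a *: f) = `|a| * C0_norm f.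
Proof.
have le b (g : C0) : C0_norm (b *: g) <= `|b| * C0_norm g.
  by apply: C0_norm_le => t; rewrite normrM ler_wpM2l// le_C0_norm.
apply/eqP; rewrite eq_le le/=; have [->|a0] := eqVneq a 0.
  by rewrite normr0 mul0r (le_trans _ (le_C0_norm _ (time0 R))).
rewrite -ler_pdivlMl ?normr_gt0// -normfV.
by rewrite -{1}[f]scale1r -(mulVf a0) -scalerA le.
Qed.

Lemma C0_normr0_eq0 (f : C0) : C0_norm f = 0 -> f = 0.
Proof.
move=> f0; apply/val_inj/funext => t; apply/eqP.
by rewrite -normr_le0; apply: le_trans (le_C0_norm f t) _; rewrite f0.
Qed.

HB.instance Definition _ :=
  @Lmodule_isNormed.Build R C0 C0_norm C0_ler_normD C0_normrZ C0_normr0_eq0.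

End C0.

Section analytic.
Variables (R : realType) (V : normedModType R).

Definition multilinear n (L : ('I_n -> V) -> R) :=
  forall (x : 'I_n -> V) (i : 'I_n), scalar (fun u => L (dfwith x i u)).

(* L need not be symmetric: symmetrizing it does not change the polynomial. *)
Definition continuous_homogeneous_polynomial n (P : V -> R) :=
  continuous P /\
  exists2 L : ('I_n -> V) -> R, multilinear L & forall h, P h = L (fun=> h).

Definition polynomial_norm (P : V -> R) : \bar R :=
  ereal_sup [set `|P h|%:E | h in [set h : V | `|h| <= 1]].

(* The series converges in norm: its homogeneous terms P n satisfy
   \sum_n `|P n| r ^ n < +oo for the supremum norm on the unit ball. *)
Definition analytic_at (f : V -> R) (x : V) :=
  exists (r : R) (P : nat -> V -> R),
    [/\ 0 < r,
        forall n, continuous_homogeneous_polynomial n (P n),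
        (\sum_(0 <= n <oo) polynomial_norm (P n) * (r ^+ n)%:E < +oo)%E &
        forall h, `|h| < r -> series (fun n => P n h) @ \oo --> f (x + h)].

Definition locally_analytic (f : V -> R) := forall x, analytic_at f x.

End analytic.

Section wiener.
Variable R : realType.

(* Taking A i = setT for some i gives the product rule for subfamilies. *)
Definition mutually_independent d (Omega : measurableType d)
    (P : probability Omega R) n (X : 'I_n -> Omega -> R) :=
  forall A : 'I_n -> set R, (forall i, measurable (A i)) ->
    P [set w | forall i, A i (X i w)] =
    (\prod_(i < n) P (X i @^-1` A i))%E.

Definition standard_brownian_motion d (Omega : measurableType d)
    (P : probability Omega R) (X : time R -> Omega -> R) :=
  [/\ forall t, measurable_fun [set: Omega] (X t),
      forall w, X (time0 R) w = 0,
      forall w, continuous (X ^~ w),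
      (* the second parameter of normal_prob is the standard deviation *)
      forall s t : time R, val s < val t ->
        forall A : set R, measurable A ->
        P [set w | A (X t w - X s w)] =
        normal_prob 0 (Num.sqrt (val t - val s)) A &
      forall (n : nat) (t : nat -> time R),
        (forall i, (i < n)%N -> val (t i) <= val (t i.+1)) ->
        mutually_independent P
          (fun (i : 'I_n) w => X (t i.+1) w - X (t i) w)].

Definition borel_C0 := g_sigma_algebraType (@open (C0 R)).

(* The paths of W are continuous on [0, pi] and start at 0, as elements of C0,
   so that W is a Brownian motion seen as an C0-valued random variable. *)
Definition wiener_measure (mu : probability borel_C0 R) :=
  exists (d : measure_display) (Omega : measurableType d)
    (P : probability Omega R) (W : {RV P >-> borel_C0}),
    standard_brownian_motion P (fun t w => (W w : C0 R) t) /\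
    forall A : set borel_C0, measurable A -> mu A = distribution P W A.

End wiener.

(* Main.v *)
(** The zero set meets each line in a countable set or contains the whole line,
    because [f] restricts to a real analytic function of one variable there.
    Let [c] be a combination of the ramps [t |-> min (t, s)].  By Tonelli, the
    set of zeros [x] of [f] with [f (x + c) <> 0], which is countable on every
    line directed by [c], has [mu]-null translates by [t c] for some [t].  By
    the Cameron-Martin formula for ramps, translation by [- t c] preserves null
    sets, so this set of zeros is itself null.  Countably many such [c] are
    dense in the path space, so every zero belongs to one of these null sets,
    as [f] is nonzero on some open set. *)

Require Import Defs.
From HB Require Import structures.
From mathcomp Require Import all_boot all_order all_algebra.
From mathcomp Require Import ring lra.
From mathcomp Require Import all_classical all_reals all_analysis.
From mathcomp Require Import measurable_realfun.

Import Order.TTheory GRing.Theory Num.Theory.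
Import numFieldNormedType.Exports.

Local Open Scope classical_set_scope.
Local Open Scope ring_scope.

(** * Zeros of real analytic functions along lines *)

Section real_analytic.
Variable R : realType.

(** Tonelli only makes almost every translate of the bad set null, and [t = 0] may be exceptional;
    this is why quasi-invariance is needed. Ramps make it elementary: a ramp shifts every dyadic
    increment before its node by a constant and leaves the later ones alone, so on product sets of
    increments the formula is a product of one-dimensional Gaussian shifts, and its density sees the
    path only through its value at the node. No stochastic integral occurs, and a combination is
    treated one ramp at a time. The obstacle is that [wiener_measure] describes increments only,
    whereas the zero set is Borel for the uniform norm. Separability bridges the gap: the same
    countable family of combinations that supplies the directions shows that evaluations at dyadic
    times generate the Borel sets. *)

Definition power_series_at (phi : R -> R) (t : R) :=
  exists (r : R) (a : nat -> R), 0 < r /\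
    forall s, `|s| < r -> series (fun n => a n * s ^+ n) @ \oo --> phi (t + s).

Lemma power_series_isolated_zero (a : nat -> R) (g : R -> R) (r : R) (m : nat) :
  0 < r ->
  (forall s, `|s| < r -> series (fun n => a n * s ^+ n) @ \oo --> g s) ->
  a m != 0 ->
  exists2 e, 0 < e & forall s, 0 < `|s| < e -> g s != 0.
Proof.
move=> r0 ag am0.
have [{am0}m am0 mmin] := @ex_minnP (fun m => a m != 0) (ex_intro _ m am0).
pose s0 := r / 2.
have s00 : 0 < s0 by rewrite /s0; lra.
have s0r : `|s0| < r by rewrite gtr0_norm// /s0; lra.
have /cvg_series_cvg_0 c0 : cvg (series (fun n => a n * s0 ^+ n) @ \oo).
  by apply/cvg_ex; exists (g s0); exact: ag.
have [M [_ MB]] := cvg_seq_bounded (cvgP _ c0).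
pose K := Num.max 1 (M + 1).
have K0 : 0 < K by rewrite /K lt_max ltr01.
have {}MB n : `|a n| * s0 ^+ n <= K.
  have MK : M < K by rewrite /K lt_max; apply/orP; right; lra.
  by have := MB K MK n I; rewrite /= normrM [X in _ * X]ger0_norm// exprn_ge0// ltW.
(* The first bound gives [q <= 1/2]; the second gives [2 K q < |a m| s0 ^ m], so that the tail bound
   [2 K q ^ (m+1)] stays below the leading term [|a m s ^ m|]. *)
pose e := Num.min (s0 / 2) (`|a m| * s0 ^+ m * s0 / (2 * K)).
have e0 : 0 < e.
  rewrite /e lt_min; apply/andP; split; first lra.
  by rewrite !mulr_gt0 ?invr_gt0 ?normr_gt0 ?exprn_gt0// mulr_gt0.
exists e => // s /andP[sp]; rewrite lt_min => /andP[ss0 se].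
apply/negP => /eqP gs0.
pose q := `|s| / s0.
have q0 : 0 < q by rewrite divr_gt0.
have q2 : 2 * q <= 1 by rewrite /q mulrA ler_pdivrMr//; lra.
have sE : `|s| = q * s0 by rewrite /q mulfVK// gt_eqF.
(* Beyond the first nonzero term, the [n]-th term is at most [K q ^ n]. *)
have part k : `|series (fun n => a n * s ^+ n) (m + k).+1 - a m * s ^+ m|
    <= K * (2 * q ^+ m.+1 - 2 * q ^+ (m + k).+1).
  (* As [q <= 1/2], the bound grows by at least [K q ^ (m+k+1)] when [k] becomes [k+1]. *)
  elim: k => [|k IH].
    rewrite addn0 subrr mulr0 /series/= big_nat_recr//= big1_seq ?add0r ?subrr ?normr0//.
    move=> i; rewrite mem_index_iota leq0n/= => im.
    case: (eqVneq (a i) 0) => [->|/mmin]; first by rewrite mul0r.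
    by rewrite leqNgt im.
  rewrite addnS seriesSr.
  have aq : `|a (m + k).+1 * s ^+ (m + k).+1| <= K * q ^+ (m + k).+1.
    rewrite normrM normrX sE exprMn mulrCA [leRHS]mulrC ler_wpM2l//.
    by rewrite exprn_ge0// ltW.
  rewrite addrAC (le_trans (ler_normD _ _))// (le_trans (lerD IH aq))//.
  rewrite [q ^+ (m + k).+2]exprS -subr_ge0.
  rewrite [leRHS](_ : _ = K * q ^+ (m + k).+1 * (1 - 2 * q)); last by ring.
  by rewrite mulr_ge0 ?subr_ge0// mulr_ge0 ?exprn_ge0 ?ltW.
have srr : `|s| < r by apply: lt_trans ss0 _; rewrite /s0; lra.
have cs := ag s srr; rewrite gs0 in cs.
have lim : `|0 - a m * s ^+ m| <= K * (2 * q ^+ m.+1).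
  have cc : (fun n => `|series (fun n => a n * s ^+ n) n - a m * s ^+ m|) @ \oo
      --> `|0 - a m * s ^+ m|.
    by apply: (@cvg_norm _ R^o); apply: (@cvgB _ R^o) => //; exact: cvg_cst.
  rewrite -(cvg_lim _ cc)//; apply: limr_le; first exact: cvgP cc.
  near=> n; have mn : (m < n)%N by near: n; exact: nbhs_infty_gt.
    have -> : n = (m + (n - m.+1)).+1 by rewrite -addSn subnKC.
    apply: le_trans (part _) _; rewrite ler_wpM2l ?(ltW K0)// gerBl.
    by rewrite mulr_ge0// exprn_ge0// ltW.
move: lim; rewrite sub0r normrN normrM normrX {1}sE exprMn exprS.
have -> : K * (2 * (q * q ^+ m)) = q ^+ m * (2 * K * q) by ring.
rewrite mulrCA ler_pM2l ?exprn_gt0//.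
move: se; rewrite ltr_pdivlMr ?mulr_gt0// => se.
rewrite leNgt /q mulrA ltr_pdivrMr// => /negP; apply.
by rewrite mulrC.
Unshelve. all: by end_near. Qed.

(** Identity theorem: the points near which [phi] vanishes form a set [S] that is open and closed,
    hence empty by connectedness as it misses [t1]. Every zero is then isolated, and a rational
    interval in which it is the only zero encodes it. *)
Lemma countable_zeros (phi : R -> R) : (forall t, power_series_at phi t) ->
  (exists t, phi t <> 0) -> countable [set t | phi t = 0].
Proof.
move=> an [t1 pt1].
have dich (t : R) : (\forall s \near t, phi s = 0) \/
    exists2 e, 0 < e & forall s, 0 < `|s - t| < e -> phi s != 0.
  have [r [a [r0 ag]]] := an t.
  have [[m am0]|all0] := pselect (exists m, a m != 0).
    right; have [e e0 He] :=
      power_series_isolated_zero a (fun s => phi (t + s)) r m r0 ag am0.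
    by exists e => // s /He; rewrite subrKC.
  left; exists r => //= s; rewrite /ball/= distrC => /ag.
  rewrite subrKC => /cvg_lim <-//.
  rewrite (_ : series _ = cst 0) ?lim_cst// funeqE => n /=.
  rewrite /series/= big1// => i _; apply/eqP; rewrite mulf_eq0; apply/orP; left.
  by apply/negP => /negP ai; apply: all0; exists i.
pose S := [set t : R | \forall s \near t, phi s = 0].
have oS : open S.
  rewrite openE => t St; rewrite /interior; near=> s.
  by near: s; exact: (near_join St).
have oSc : open (~` S).
  rewrite openE => t St; rewrite /interior.
  have [//|[e e0 He]] := dich t.
  exists e => //= s ts Ss.
  have [st|st] := eqVneq s t; first by rewrite st in Ss.
  have := nbhs_singleton Ss => ps.
  have := He s; rewrite ps eqxx distrC; move: ts; rewrite /ball/= => ->.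
  by rewrite andbT normr_gt0 subr_eq0 eq_sym st => /(_ isT).
have noS t : ~ S t.
  move=> St; have : S = setT.
    have /(_ S) : connected [set: R] by apply/connected_intervalP => ? ? ? ? ? ?.
    apply; first by exists t.
      by exists S => //; rewrite setTI.
    by exists S; [rewrite -(setCK S); exact: open_closedC|rewrite setTI].
  move=> ST; have : S t1 by rewrite ST.
  by move=> /nbhs_singleton.
have iso t : exists pq : rat * rat, phi t = 0 ->
    [/\ ratr pq.1 < t, t < ratr pq.2 &
      forall s, ratr pq.1 < s -> s < ratr pq.2 -> phi s = 0 -> s = t].
  have [/noS//|[e e0 He]] := dich t.
  have /rat_in_itvoo[p] : t - e < t by rewrite gtrBl.
  have /rat_in_itvoo[q] : t < t + e by rewrite ltrDl.
  rewrite !in_itv/= => /andP[q1 q2] /andP[p1 p2].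
  exists (p, q) => _; split => //= s s1 s2 ps.
  apply/eqP; apply: contraTT isT => st.
  have := He s; rewrite ps eqxx; apply.
  rewrite normr_gt0 subr_eq0 st/= ltr_norml; apply/andP; split; lra.
have [c cP] := choice iso.
apply/countable_injP; exists (pickle \o c) => t t' /[!inE]/= zt zt'.
move=> /(pcan_inj pickleK) ctt'.
have [h1 h2 h3] := cP t zt; have [h1' h2' h3'] := cP t' zt'.
by apply: h3'; rewrite // -ctt'.
Unshelve. all: by end_near. Qed.

End real_analytic.

Section restriction_to_lines.
Variables (R : realType) (V : normedModType R).

Lemma multilinear_homogeneous n (L : ('I_n -> V) -> R) (s : R) (h : V) :
  multilinear L -> L (fun=> s *: h) = s ^+ n * L (fun=> h).
Proof.
move=> mL.
have LZ x i a u : L (dfwith x i (a *: u)) = a * L (dfwith x i u).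
  have L0 : L (dfwith x i 0) = 0.
    by have := mL x i 1 0 0; rewrite /= scaler0 addr0 mul1r => /eqP;
      rewrite -subr_eq0 opprD addNKr oppr_eq0 => /eqP.
  by have := mL x i a u 0; rewrite /= addr0 L0 addr0.
(* The factor [s] is pulled out of one argument at a time; the first [k] arguments are the scaled
   ones. *)
suff H k : (k <= n)%N ->
    L (fun i : 'I_n => if (i < k)%N then s *: h else h) = s ^+ k * L (fun=> h).
  rewrite -(H n (leqnn n)); congr L; apply/funext => i.
  by rewrite ltn_ord.
elim: k => [_|k IH kn].
  by rewrite expr0 mul1r; congr L.
pose x (i : 'I_n) := if (i < k)%N then s *: h else h.
pose ik := Ordinal kn.
have xE u : dfwith x ik u = fun i : 'I_n => if i == ik then u else x i.
  apply/funext => i; have [->|ne] := eqVneq i ik; first by rewrite dfwithin.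
  by rewrite dfwithout// eq_sym.
have := LZ x ik s h; rewrite !xE => LZx.
rewrite exprS -mulrA -IH ?(ltnW kn)//.
have -> : L (fun i : 'I_n => if (i < k)%N then s *: h else h) =
    L (fun i => if i == ik then h else x i).
  congr L; apply/funext => i; rewrite /x; case: eqVneq => [->|//]/=.
  by rewrite ltnn.
rewrite -LZx; congr L; apply/funext => i; rewrite /x ltnS leq_eqVlt.
by rewrite -val_eqE /=; case: eqVneq.
Qed.

(** The expansion is taken at [x + t *: h] itself, and homogeneity turns [P n (s *: h)] into the
    monomial [P n h * s ^+ n]. Adding 1 to the norm of [h] in the radius covers [h = 0]. *)
Lemma analytic_line (f : V -> R) (x h : V) (t : R) : locally_analytic f ->
  power_series_at R (fun t => f (x + t *: h)) t.
Proof.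
move=> /(_ (x + t *: h))[r [P [r0 hP _ cP]]].
have h1 : 0 < `|h| + 1 by rewrite ltr_wpDl.
exists (r / (`|h| + 1)), (fun n => P n h); split=> [|s].
  by rewrite divr_gt0.
rewrite ltr_pdivlMr// => sr.
have /cP : `|s *: h| < r.
  by rewrite normrZ (le_lt_trans _ sr)// ler_wpM2l// lerDl.
rewrite -addrA -scalerDl.
suff -> : (fun n => P n h * s ^+ n) = (fun n => P n (s *: h)) by [].
apply/funext => n; have [_ [L mL LE]] := hP n.
by rewrite !LE multilinear_homogeneous// mulrC.
Qed.

Lemma countable_zeros_line (f : V -> R) (x h : V) : locally_analytic f ->
  (exists t : R, f (x + t *: h) <> 0) ->
  countable [set t : R | f (x + t *: h) = 0].
Proof. by move=> fa; apply: countable_zeros => t; exact: analytic_line. Qed.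

End restriction_to_lines.

(** * Ramps and their density in the path space *)

Section ramps.
Variable R : realType.
Implicit Types (x y : C0 R) (s t : time R).

Lemma C0_D x y t : (x + y) t = x t + y t. Proof. by []. Qed.
Lemma C0_B x y t : (x - y) t = x t - y t. Proof. by []. Qed.
Lemma C0_Z (a : R) x t : (a *: x) t = a * x t. Proof. by []. Qed.

Lemma C0_sum (I : Type) (r : seq I) (P : pred I) (F : I -> C0 R) t :
  (\sum_(i <- r | P i) F i) t = \sum_(i <- r | P i) F i t.
Proof. by elim/big_rec2 : _ => // i y1 y2 _ <-. Qed.

Lemma C0_continuous x : continuous x.
Proof. by have /set_mem[] := C0_funP x. Qed.

Lemma C0_at0 x : x (time0 R) = 0.
Proof. by have /set_mem[] := C0_funP x. Qed.

Lemma time_itv t : 0 <= val t <= pi.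
Proof. by have := set_valP t; rewrite /= in_itv. Qed.

Lemma time_val_continuous : continuous (val : time R -> R).
Proof. exact: initial_continuous. Qed.

Lemma ramp_subproof s : (fun t : time R => Num.min (val t) (val s)) \in @C0_pred R.
Proof.
rewrite inE/=; split; last first.
  by rewrite /time0/= min_l//; case/andP: (time_itv s).
move=> t; apply: (@continuous_min _ _ (val : time R -> R) (cst (val s))).
  exact: time_val_continuous.
exact: cst_continuous.
Qed.

Definition ramp s : C0 R := mkC0 (ramp_subproof s).

Lemma rampE s t : ramp s t = Num.min (val t) (val s). Proof. by []. Qed.

Definition mesh n : R := pi / 2 ^+ n.

Lemma mesh_gt0 n : 0 < mesh n.
Proof. by rewrite divr_gt0 ?pi_gt0// exprn_gt0. Qed.

Lemma dyad_subproof n k : mesh n *+ minn k (2 ^ n) \in `[(0 : R), pi]%classic.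
Proof.
rewrite inE/= in_itv/= mulrn_wge0 ?(ltW (mesh_gt0 n))//=.
apply: (@le_trans _ _ (mesh n *+ (2 ^ n)%N)).
  by rewrite -![mesh n *+ _]mulr_natr ler_wpM2l ?(ltW (mesh_gt0 n))// ler_nat geq_minr.
by rewrite -mulr_natr /mesh natrX mulfVK// expf_neq0.
Qed.

(* Indices beyond [2 ^ n] are clamped to the last node [pi]. *)
Definition dyad n k : time R := exist _ (mesh n *+ minn k (2 ^ n)) (dyad_subproof n k).

Lemma dyadE n k : (k <= 2 ^ n)%N -> val (dyad n k) = mesh n *+ k.
Proof. by move=> kn; rewrite /dyad/= (minn_idPl kn). Qed.

Lemma dyad0 n : dyad n 0 = time0 R.
Proof. by apply: val_inj; rewrite /= min0n. Qed.

Lemma dyad_last n : val (dyad n (2 ^ n)) = pi.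
Proof. by rewrite dyadE// -mulr_natr /mesh natrX mulfVK// expf_neq0. Qed.

Lemma mesh_refine n m : (n <= m)%N -> mesh n = mesh m *+ 2 ^ (m - n).
Proof.
move=> nm; rewrite -mulr_natr natrX /mesh -{1}(subnKC nm) exprD.
by field; rewrite !expf_neq0.
Qed.

Lemma dyad_refine n m k : (n <= m)%N -> (k <= 2 ^ n)%N ->
  dyad n k = dyad m (k * 2 ^ (m - n)).
Proof.
move=> nm kn; apply: val_inj; rewrite !dyadE//; last first.
  by rewrite -[X in (_ <= 2 ^ X)%N](subnKC nm) expnD leq_mul2r kn orbT.
by rewrite (mesh_refine n m nm) -mulrnA mulnC.
Qed.

Lemma dyad_cell (d : R) : 0 < d -> exists2 n, mesh n < d &
  forall t, exists2 k, (k < 2 ^ n)%N & mesh n *+ k <= val t <= mesh n *+ k.+1.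
Proof.
(* This [n] exceeds [pi / d], and [2 ^ n > n]. *)
move=> d0; exists (Num.truncn (pi / d)).+1.
  rewrite /mesh ltr_pdivrMr ?exprn_gt0//.
  rewrite mulrC -ltr_pdivrMr// (lt_trans (truncnS_gt _))//.
  by rewrite -natrX ltr_nat ltn_expl.
move=> t; set n := _.+1.
have find_cell (m : R) N (u : R) : (0 < N)%N -> 0 <= u <= m *+ N ->
    exists2 k, (k < N)%N & m *+ k <= u <= m *+ k.+1.
  elim: N => // -[_ _ u0|N IH _ /andP[u0 uN]]; first by exists 0%N.
  have [uN1|uN1] := leP u (m *+ N.+1).
    by have [|k kN hk] := IH isT; rewrite ?u0//; exists k => //; rewrite ltnW.
  by exists N.+1; rewrite // (ltW uN1) uN.
apply: find_cell; first by rewrite expn_gt0.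
by rewrite -dyadE// dyad_last time_itv.
Qed.

End ramps.

Section density.
Variable R : realType.
Implicit Types (x y : C0 R) (s t : time R).

(** Heine-Cantor. Composing with [clip], the retraction of the line onto [[0, pi]], replaces the
    subtype by the segment, whose compactness is used as near-covering for the filter of small radii
    [d]. *)
Lemma C0_uniform_continuous x (e : R) : 0 < e ->
  exists2 d, 0 < d & forall s t, `|val s - val t| < d -> `|x s - x t| < e.
Proof.
move=> e0.
have clip_subproof (u : R) : Num.max 0 (Num.min u pi) \in `[(0 : R), pi]%classic.
  by rewrite inE/= in_itv/= le_max lexx/= ge_max pi_ge0 ge_min lexx orbT.
pose clip u : time R := exist _ (Num.max 0 (Num.min u pi)) (clip_subproof u).
have clipE t : clip (val t) = t.
  apply: val_inj => /=; have /andP[t0 tp] := time_itv R t.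
  by rewrite min_l// max_r.
have cclip : continuous (x \o clip).
  move=> u; apply: continuous_comp; last exact: C0_continuous.
  move: u; apply: continuous_comp_initial => u.
  apply: (@continuous_max _ _ (cst 0) (fun u => Num.min u pi)).
    exact: cst_continuous.
  by apply: (@continuous_min _ _ id (cst pi)); [exact: id|exact: cst_continuous].
have /compact_near_coveringP := @segment_compact R 0 pi.
move=> /(_ _ (0^'+)
  (fun d u => forall v, `|u - v| < d -> `|x (clip u) - x (clip v)| < e) _).
case.
  move=> u _; have /cvgrPdist_lt/(_ (e / 2)) := cclip u.
  rewrite divr_gt0// => /(_ isT)[r /= r0 hr].
  (* With [u'] within [r / 2] of [u] and [d < r / 2], both [u'] and [v] lie in the ball of radius
     [r] about [u], and two errors of [e / 2] add up. *)
  exists (ball u (r / 2), [set d | 0 < d < r / 2]) => /=.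
    split; first by apply: nbhsx_ballx; lra.
    exists (r / 2) => /=; first lra.
    move=> d /=; rewrite sub0r normrN => dr d0; rewrite d0/=.
    by rewrite (le_lt_trans (ler_norm _)).
  move=> [u' d] [/= uu' /andP[d0 dr]] v u'v.
  have h1 : ball u r u' by apply: le_ball uu'; lra.
  have h2 : ball u r v.
    rewrite /ball/= in uu' *.
    rewrite (le_lt_trans (ler_distD u' _ _))//; lra.
  have := hr _ h1; have := hr _ h2; rewrite /=.
  set a := x (clip u); set b := x (clip v); set c := x (clip u').
  move=> hb hc; rewrite (le_lt_trans (ler_distD a _ _))//.
  by rewrite (distrC c a); lra.
move=> r /= r0 hr; exists (r / 2); first lra.
move=> s t st; have := hr (r / 2); rewrite /= sub0r normrN.
rewrite gtr0_norm; last lra.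
move=> /(_ ltac:(lra) ltac:(lra) (val s) (set_valP s) (val t) st).
by rewrite !clipE.
Qed.

(** The index type is countable: dyadic nodes and rational coefficients. *)
Definition ramp_comb (l : seq (nat * nat * rat)) : C0 R :=
  \sum_(p <- l) ratr p.2 *: ramp R (dyad R p.1.1 p.1.2).

(** The uniform closure of the combinations. It is stable under sums and contains the real multiples
    of dyadic ramps, hence the piecewise linear interpolants of paths on dyadic grids. *)
Let V : set (C0 R) := [set x | forall e : R, 0 < e -> exists l, `|x - ramp_comb l| < e].

Let V0 : V 0.
Proof. by move=> e e0; exists [::]; rewrite /ramp_comb big_nil subr0 normr0. Qed.

Let VD x y : V x -> V y -> V (x + y).
Proof.
move=> Vx Vy e e0; have e20 : 0 < e / 2 by rewrite divr_gt0.
have [l1 h1] := Vx _ e20; have [l2 h2] := Vy _ e20.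
exists (l1 ++ l2); rewrite /ramp_comb big_cat/= opprD addrACA.
rewrite (le_lt_trans (ler_normD _ _))//.
by rewrite [e]splitr ltrD.
Qed.

Let VZ (a : R) n k : V (a *: ramp R (dyad R n k)).
Proof.
move=> e e0; set r := ramp _ _.
have r0 : 0 < `|r| + 1 by rewrite ltr_wpDl.
have /rat_in_itvoo[q] : a - e / (`|r| + 1) < a + e / (`|r| + 1).
  by rewrite ltrD2l gtrN// divr_gt0.
rewrite in_itv/= -ltr_distlC ltr_pdivlMr// => qa.
exists [:: (n, k, q)]; rewrite /ramp_comb big_seq1/= -scalerBl.
by rewrite normrZ (le_lt_trans _ qa)// distrC ler_wpM2l// lerDl.
Qed.

Let V_closed x : (forall e : R, 0 < e -> exists2 y, V y & `|x - y| < e) -> V x.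
Proof.
move=> Vx e e0; have e20 : 0 < e / 2 by rewrite divr_gt0.
have [y /(_ _ e20)[l yl] xy] := Vx _ e20; exists l.
rewrite -[x - _](subrKA y) (le_lt_trans (ler_normD _ _))//.
by rewrite [e]splitr ltrD.
Qed.

(** A difference of consecutive ramps is 0 up to node [j], rises with slope 1 and is then constant;
    with the slopes of the chords as coefficients the sum is the piecewise linear interpolation of
    [x]. *)
Let interp n x : C0 R := \sum_(j < 2 ^ n)
  ((x (dyad R n j.+1) - x (dyad R n j)) / mesh R n) *:
   (ramp R (dyad R n j.+1) - ramp R (dyad R n j)).

Let V_interp n x : V (interp n x).
Proof.
apply: big_ind => // j _.
by rewrite scalerBr -scaleNr; apply: VD; exact: VZ.
Qed.

(** Cells before [k] contribute their full increments, which telescope to [x (dyad R n k)] since [x]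
    starts at 0; later cells contribute 0. *)
Let interpE n x k t : (k < 2 ^ n)%N -> mesh R n *+ k <= val t <= mesh R n *+ k.+1 ->
  interp n x t = x (dyad R n k) +
    (x (dyad R n k.+1) - x (dyad R n k)) * ((val t - mesh R n *+ k) / mesh R n).
Proof.
move=> kn /andP[kt tk]; rewrite /interp C0_sum.
have m0 := mesh_gt0 R n.
have mle i j : (i <= j)%N -> mesh R n *+ i <= mesh R n *+ j.
  by move=> ij; rewrite -![mesh R n *+ _]mulr_natr ler_wpM2l ?(ltW m0)// ler_nat.
pose F j := (x (dyad R n j.+1) - x (dyad R n j)) / mesh R n *
  (Num.min (val t) (mesh R n *+ j.+1) - Num.min (val t) (mesh R n *+ j)).
rewrite (eq_bigr (fun j : 'I__ => F j)); last first.
  by move=> j _; rewrite C0_Z C0_B !rampE !dyadE// ltnW.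
rewrite -(big_mkord xpredT F) (big_cat_nat (n := k))//=; last exact: ltnW.
rewrite (big_ltn kn) addrA; rewrite [X in _ + X]big1_seq ?addr0; last first.
  move=> j; rewrite mem_index_iota => /andP[_ /andP[kj _]].
  rewrite /F !min_l ?subrr ?mulr0// (le_trans tk)// mle//.
  by rewrite ltnW.
congr (_ + _); last first.
  by rewrite /F (min_l tk) (min_r kt) mulrAC mulrA.
transitivity (\sum_(0 <= j < k) (x (dyad R n j.+1) - x (dyad R n j))).
  apply: eq_big_nat => j /andP[_ jk]; rewrite /F !min_r.
  - by rewrite mulrS addrK mulfVK// gt_eqF.
  - by rewrite (le_trans _ kt)// mle// ltnW.
  - by rewrite (le_trans _ kt)// mle.
by rewrite telescope_sumr// dyad0 C0_at0 subr0.
Qed.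

Lemma ramp_comb_dense x (e : R) : 0 < e -> exists l, `|x - ramp_comb l| < e.
Proof.
move: e; apply: V_closed => e e0.
(* Two errors of [e / 4], from [x] and from the chord, give at most [e / 2]: the supremum loses
   strictness, and the spare half of [e] restores it. *)
have e40 : 0 < e / 4 by rewrite divr_gt0.
have [d d0 hd] := C0_uniform_continuous x _ e40.
have [n nd cell] := dyad_cell R _ d0.
exists (interp n x); first exact: V_interp.
suff : C0_norm (x - interp n x) <= e / 2.
  by move=> /le_lt_trans; apply; lra.
apply: C0_norm_le => t; rewrite C0_B.
have [k kn kt] := cell t.
rewrite (interpE _ _ _ _ kn kt).
have m0 := mesh_gt0 R n.
move: (kt) => /andP[kt1 kt2].
have h1 : `|x t - x (dyad R n k)| < e / 4.
  apply: hd; rewrite dyadE ?(ltnW kn)// ger0_norm ?subr_ge0//.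
  by rewrite (le_lt_trans _ nd)// lerBlDr -mulrS.
have h2 : `|x (dyad R n k.+1) - x (dyad R n k)| < e / 4.
  by apply: hd; rewrite !dyadE ?(ltnW kn)// mulrS addrK gtr0_norm.
have h3 : `|(val t - mesh R n *+ k) / mesh R n| <= 1.
  rewrite ger0_norm; last by rewrite divr_ge0 ?subr_ge0 ?(ltW m0).
  by rewrite ler_pdivrMr// mul1r lerBlDr -mulrS.
set b := x (dyad R n k.+1) - x (dyad R n k) in h2 *.
set c := _ / mesh R n in h3 *.
have h4 := ler_normB (x t - x (dyad R n k)) (b * c).
have h5 := ler_wpM2l (normr_ge0 b) h3.
by rewrite opprD addrA (le_trans h4)// normrM; lra.
Qed.

End density.

(** * Borel sets of the path space *)

Section normed_topology.
Variables (R : realType) (V : normedModType R).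

Lemma contraction_continuous (f : V -> R) :
  (forall x y, `|f x - f y| <= `|x - y|) -> continuous f.
Proof.
move=> fxy x; apply/cvgrPdist_lt => e e0; near=> y.
apply: le_lt_trans (fxy _ _) _.
by near: y; exact: cvgr_dist_lt.
Unshelve. all: by end_near. Qed.

Lemma open_ball_sub (U : set V) x : open U -> U x ->
  exists2 e : R, 0 < e & forall y, `|x - y| < e -> U y.
Proof.
move=> oU Ux; have : nbhs x U by exact: open_nbhs_nbhs.
rewrite -nbhs_ballE => -[e /= e0 He]; exists e => // y xy.
by apply: He; rewrite -ball_normE.
Qed.

End normed_topology.

Section borel_evaluations.
Variable R : realType.
Implicit Types (x y : C0 R) (s t : time R).

(** By uniform continuity, a value above [r] would persist at a nearby node. This writes a closed
    ball as a countable intersection of conditions on evaluations. *)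
Lemma le_C0_norm_dyad x (r : R) : (forall n k, `|x (dyad R n k)| <= r) ->
  `|x| <= r.
Proof.
move=> xr; apply: C0_norm_le => t; rewrite leNgt; apply/negP => rx.
have e0 : 0 < `|x t| - r by rewrite subr_gt0.
have [d d0 hd] := C0_uniform_continuous R x _ e0.
have [n nd /(_ t)[k kn /andP[kt1 kt2]]] := dyad_cell R _ d0.
have := hd t (dyad R n k); rewrite dyadE ?(ltnW kn)// ger0_norm ?subr_ge0//.
have -> : val t - mesh R n *+ k < d by rewrite (le_lt_trans _ nd)// lerBlDr -mulrS.
move=> /(_ isT); apply/negP; rewrite -leNgt.
rewrite (le_trans _ (lerB_dist _ _))//; have := xr n k; lra.
Qed.

Definition dyadic_evals n : set (set (C0 R)) :=
  [set A | exists k B, measurable B /\ A = (fun x : C0 R => x (dyad R n k)) @^-1` B].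

Lemma measurable_continuous_C0 (f : C0 R -> R) : continuous f ->
  measurable_fun [set: borel_C0 R] (f : borel_C0 R -> R).
Proof.
move=> cf; apply: (measurability _ (@RGenOpens.measurableE R)).
move=> _ [_ [a [b ->] <-]]; rewrite setTI; apply: sub_sigma_algebra.
by move/continuousP : cf; apply; exact: interval_open.
Qed.

Lemma eval_continuous t : continuous (fun x : C0 R => x t).
Proof.
by apply: (@contraction_continuous R (C0 R)) => x y; exact: (le_C0_norm (x - y)).
Qed.

Lemma measurable_eval t :
  measurable_fun [set: borel_C0 R] (fun x : borel_C0 R => (x : C0 R) t).
Proof. by apply: measurable_continuous_C0; exact: eval_continuous. Qed.

(** By density, an open set is the union of those closed balls inside it that have centre
    [ramp_comb R l] and radius [1 / (m+1)], a countable family; each ball is a countable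
    intersection of preimages under evaluations. *)
Lemma borel_C0_dyadic :
  @measurable _ (borel_C0 R) = <<s \bigcup_n dyadic_evals n >>.
Proof.
apply/seteqP; split; last first.
  apply: smallest_sub; first exact: sigma_algebra_measurable.
  move=> _ [n _ [k [B [mB ->]]]].
  by rewrite -[X in measurable X]setTI; exact: measurable_eval.
apply: smallest_sub; first exact: smallest_sigma_algebra.
move=> U oU; pose G := \bigcup_n dyadic_evals n.
pose F (p : seq (nat * nat * rat) * nat) : set (C0 R) :=
  [set x | `|x - ramp_comb R p.1| <= p.2.+1%:R^-1].
have mF p : <<s G >> (F p).
  have -> : F p = \bigcap_n \bigcap_k
      [set x : C0 R | `|x (dyad R n k) - ramp_comb R p.1 (dyad R n k)| <= p.2.+1%:R^-1].
    apply/seteqP; split => x /=.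
      by move=> xp n _ k _; apply: le_trans xp; exact: (le_C0_norm (x - _)).
    by move=> xp; apply: le_C0_norm_dyad => n k; rewrite C0_B; exact: xp.
  apply: (@bigcapT_measurable _ (g_sigma_algebraType G)) => n.
  apply: (@bigcapT_measurable _ (g_sigma_algebraType G)) => k.
  apply: sub_sigma_algebra; exists n => //; exists k.
  exists [set u : R | `|u - ramp_comb R p.1 (dyad R n k)| <= p.2.+1%:R^-1]; split => //.
  rewrite (_ : [set _ | _] =
    (fun u : R => `|u - ramp_comb R p.1 (dyad R n k)|) @^-1`
      `]-oo, p.2.+1%:R^-1]); last first.
    by apply/seteqP; split => u /=; rewrite in_itv.
  rewrite -[X in measurable X]setTI.
  suff : measurable_fun setT (fun u : R => `|u - ramp_comb R p.1 (dyad R n k)|) by apply.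
  by apply: measurableT_comp => //; exact: measurable_funB.
have -> : U = \bigcup_p (if `[< F p `<=` U >] then F p else set0).
  apply/seteqP; split; last first.
    by move=> x [p _]; case: ifPn => // /asboolP FU /FU.
  move=> x Ux; have [e e0 He] := @open_ball_sub R (C0 R) U x oU Ux.
  (* The centre may be [1 / (m+1)] away from [x], and the ball extends as far beyond it, hence
     [e / 2]. *)
  have [m me] : exists m, m.+1%:R^-1 < e / 2.
    exists (Num.truncn (2 / e)); rewrite invf_plt ?posrE ?divr_gt0//.
    by rewrite invf_div truncnS_gt.
  have m0 : 0 < m.+1%:R^-1 :> R by rewrite invr_gt0.
  have [l xl] := ramp_comb_dense R x _ m0.
  exists (l, m) => //; rewrite ifT; first by rewrite /F/= ltW.
  apply/asboolP => y; rewrite /F/= => yl; apply: He.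
  rewrite distrC in yl; apply: le_lt_trans (ler_distD (ramp_comb R l) _ _) _.
  by apply: lt_trans (ltr_leD xl yl) _; rewrite [ltRHS]splitr ltrD.
apply: (@countable_bigcupT_measurable _ (g_sigma_algebraType G)).
  exact: countableP.
by move=> p; case: ifPn => _; [exact: mF|exact: (@measurable0 _ (g_sigma_algebraType G))].
Qed.

(** Serves for [x |-> x + c] and for [(x, t) |-> x + t *: c], whose coordinates are visibly
    measurable. *)
Lemma measurable_fun_C0 d (T : measurableType d) (F : T -> borel_C0 R) :
  (forall t, measurable_fun setT (fun w => (F w : C0 R) t)) ->
  measurable_fun setT F.
Proof.
move=> mF; apply: (measurability _ borel_C0_dyadic).
move=> _ [_ [n _ [k [B [mB ->]]]] <-].
exact: mF.
Qed.

End borel_evaluations.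

(** * Densities and independence *)

Definition pushforward_measure d d' (T1 : measurableType d)
    (T2 : measurableType d') (R : realType) (m : {measure set T1 -> \bar R})
    (f : T1 -> T2) (mf : measurable_fun setT f) : {measure set T2 -> \bar R} :=
  measure_function_pushforward__canonical__measure_function_Measure m mf.
Arguments pushforward_measure {d d' T1 T2 R} m {f}.

Section density_measure.
Local Open Scope ereal_scope.
Context d (T : measurableType d) (R : realType).
Variables (mu : {measure set T -> \bar R}) (g : T -> R).
Hypotheses (mg : measurable_fun setT g) (g0 : forall x, (0 <= g x)%R).

(** The proofs are arguments of the definition so that the measure instance can be recovered from
    the term. *)
Definition density_measure of measurable_fun setT g & (forall x, (0 <= g x)%R) :=
  fun A : set T => \int[mu]_(x in A) (g x)%:E.

Local Notation nu := (density_measure mg g0).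

Let nu0 : nu set0 = 0. Proof. exact: integral_set0. Qed.

Let nu_ge0 A : 0 <= nu A.
Proof. by apply: integral_ge0 => x _; rewrite lee_fin. Qed.

Let nu_sigma_additive : semi_sigma_additive nu.
Proof.
move=> F mF tF mUF.
have mg' : measurable_fun (\bigcup_n F n) (fun x => (g x)%:E).
  by apply: measurable_funTS; exact/measurable_EFinP.
rewrite /density_measure ge0_integral_bigcup//; last by move=> x _; rewrite lee_fin.
apply: is_cvg_ereal_nneg_natsum => n _.
by apply: integral_ge0 => x _; rewrite lee_fin.
Qed.

HB.instance Definition _ := isMeasure.Build _ _ _ nu nu0 nu_ge0 nu_sigma_additive.

Import HBNNSimple.

(** Stated for any measure with the values of [density_measure], so as to apply to [normal_prob]
    too. Monotone approximation reduces it to simple functions. *)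
Lemma ge0_integral_density (nu' : {measure set T -> \bar R}) (f : T -> \bar R) :
  (forall A, measurable A -> nu' A = \int[mu]_(x in A) (g x)%:E) ->
  measurable_fun setT f -> (forall x, 0 <= f x) ->
  \int[nu']_x f x = \int[mu]_x (f x * (g x)%:E).
Proof.
move=> nu'E mf f0.
have mEg : measurable_fun setT (fun x => (g x)%:E) by exact/measurable_EFinP.
pose f_ := nnsfun_approx measurableT mf.
transitivity (limn (fun n => \int[nu']_x (f_ n x)%:E)).
  rewrite -monotone_convergence//.
  - by apply: eq_integral => y _; apply/esym/cvg_lim => //; exact: cvg_nnsfun_approx.
  - by move=> n; exact/measurable_EFinP/measurable_funP.
  - by move=> n y _; rewrite lee_fin.
  - by move=> y _ m n mn; rewrite lee_fin; exact/lefP/nd_nnsfun_approx.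
rewrite [X in limn X](_ : _ = (fun n => \int[mu]_x ((f_ n x)%:E * (g x)%:E))).
  rewrite -monotone_convergence//; last 3 first.
  - by move=> n; apply: emeasurable_funM => //; exact/measurable_EFinP/measurable_funP.
  - by move=> n y _; rewrite mule_ge0// lee_fin.
  - move=> y _ m n mn; rewrite lee_wpmul2r ?lee_fin//.
    exact/lefP/nd_nnsfun_approx.
  apply: eq_integral => y _; apply/cvg_lim => //.
  by apply: cvgeZr => //; exact: cvg_nnsfun_approx.
apply/funext => n.
have mfn r : measurable (f_ n @^-1` [set r]) by [].
rewrite integralT_nnsfun sintegralE.
under [RHS]eq_integral => x _.
  rewrite fimfunE -fsumEFin// ge0_mule_fsuml; last first.
    by move=> r; exact: nnfun_muleindic_ge0.
  over.
rewrite ge0_integral_fsum//; last 2 first.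
- move=> r; apply: emeasurable_funM => //.
  by apply/measurable_EFinP; exact: measurable_funM.
- by move=> r x _; rewrite mule_ge0 ?lee_fin//; exact: nnfun_muleindic_ge0.
apply: eq_fsbigr => r rn.
have [x _ <-] := set_mem rn.
have -> : nu' (f_ n @^-1` [set f_ n x]) =
    \int[mu]_y ((\1_(f_ n @^-1` [set f_ n x]) y)%:E * (g y)%:E).
  rewrite nu'E// integral_mkcond; apply: eq_integral => y _.
  by rewrite epatch_indic muleC.
rewrite -ge0_integralZl ?lee_fin//.
- by apply: eq_integral => y _; rewrite muleA.
- by apply: emeasurable_funM => //; apply/measurable_EFinP.
- by move=> y _; rewrite mule_ge0 ?lee_fin.
Qed.

End density_measure.
Arguments density_measure {d T R} mu {g}.

Section independence.
Local Open Scope ereal_scope.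
Context d (T : measurableType d) (R : realType) (P : probability T R).

(** The condition on indicators says that the image under [Y] of [P] weighted by [G] is [C] times
    the law of [Y]; [g] is integrated against both. *)
Lemma integral_comp_indep (Y G : T -> R) (C : R) (g : R -> R) :
  measurable_fun setT Y -> measurable_fun setT G -> measurable_fun setT g ->
  (forall w, (0 <= G w)%R) -> (0 <= C)%R -> (forall y, (0 <= g y)%R) ->
  (forall A, measurable A ->
    \int[P]_w (\1_A (Y w) * G w)%:E = C%:E * P (Y @^-1` A)) ->
  \int[P]_w (g (Y w) * G w)%:E = C%:E * \int[P]_w (g (Y w))%:E.
Proof.
move=> mY mG mg G0 C0 g0 H.
have mEg : measurable_fun setT (fun y => (g y)%:E) by exact/measurable_EFinP.
have mYA A : measurable A -> measurable (Y @^-1` A).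
  by move=> mA; rewrite -[X in measurable X]setTI; exact: mY.
transitivity (\int[pushforward_measure (density_measure P mG G0) mY]_y (g y)%:E).
  rewrite ge0_integral_pushforward//; last by move=> y _; rewrite lee_fin.
  rewrite preimage_setT (@ge0_integral_density _ _ _ P G)//.
    exact: measurableT_comp.
  by move=> x; rewrite lee_fin.
transitivity (\int[mscale (NngNum C0) (pushforward_measure P mY)]_y (g y)%:E); last first.
  rewrite ge0_integral_mscale//; last by move=> y _; rewrite lee_fin.
  by rewrite ge0_integral_pushforward//; move=> y _; rewrite lee_fin.
apply: eq_measure_integral => A mA _.
transitivity (\int[P]_w (\1_A (Y w) * G w)%:E); last exact: H.
rewrite [LHS]integral_mkcond.
apply: eq_integral => w _; rewrite epatch_indic muleC.
by rewrite EFinM.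
Qed.

Lemma integral_prod_independent n (Y : 'I_n -> T -> R) (g : 'I_n -> R -> R)
    (c : 'I_n -> R) :
  (forall i, measurable_fun setT (Y i)) -> (forall i, measurable_fun setT (g i)) ->
  (forall i y, (0 <= g i y)%R) -> mutually_independent P Y ->
  (forall i, \int[P]_w (g i (Y i w))%:E = (c i)%:E) ->
  \int[P]_w (\prod_(i < n) g i (Y i w))%:E = (\prod_(i < n) c i)%:E.
Proof.
move=> mY mg g0 indY gc.
have mYA i A : measurable A -> measurable (Y i @^-1` A).
  by move=> mA; rewrite -[X in measurable X]setTI; exact: mY.
have c0 i : (0 <= c i)%R.
  by rewrite -lee_fin -gc; apply: integral_ge0 => w _; rewrite lee_fin.
(* The indicators are traded for the [g i] one index at a time. *)
pose h k (A : 'I_n -> set R) (i : 'I_n) : R -> R :=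
  if (i < k)%N then g i else \1_(A i).
pose p k (A : 'I_n -> set R) (i : 'I_n) : R :=
  if (i < k)%N then c i else fine (P (Y i @^-1` A i)).
have mh k A i : (forall i, measurable (A i)) -> measurable_fun setT (h k A i).
  by move=> mA; rewrite /h; case: ifP.
have h0 k A i y : (0 <= h k A i y)%R by rewrite /h; case: ifP.
have p0 k A i : (0 <= p k A i)%R by rewrite /p; case: ifP => // _; exact: fine_ge0.
suff H k : (k <= n)%N -> forall A, (forall i, measurable (A i)) ->
    \int[P]_w (\prod_(i < n) h k A i (Y i w))%:E = (\prod_(i < n) p k A i)%:E.
  have := H n (leqnn n) (fun=> setT) (fun=> measurableT).
  under eq_integral do under eq_bigr do rewrite /h ltn_ord.
  by under [in RHS]eq_bigr do rewrite /p ltn_ord.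
elim: k => [_ A mA|k IH kn A mA].
  have -> : (\prod_(i < n) p 0 A i)%:E = \prod_(i < n) P (Y i @^-1` A i).
    rewrite -prodEFin; apply: eq_bigr => i _.
    by rewrite /p ltn0 fineK// fin_num_measure//; exact: mYA.
  rewrite -indY// (_ : [set w | _] = \bigcap_(i in [set: 'I_n]) (Y i @^-1` A i)); last first.
    by apply/seteqP; split => w /= h' i; [move=> _|]; exact: h'.
  rewrite -(setIT (\bigcap_(i in _) _)) -integral_indic//.
  - apply: eq_integral => w _; congr EFin.
    rewrite indicE; case: (pselect ((\bigcap_(i in [set: 'I_n]) (Y i @^-1` A i)) w)) => hw.
      rewrite mem_set// big1// => i _.
      by rewrite /h ltn0 indicE mem_set//; exact: hw.
    rewrite memNset//; move: hw => /existsNP[i] /not_implyP[_ nA].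
    by rewrite (bigD1 i)//= /h ltn0 indicE memNset// mul0r.
  - by apply: fin_bigcap_measurable => // i _; exact: mYA.
pose j := Ordinal kn.
pose G w := (\prod_(i < n | i != j) h k A i (Y i w))%R.
pose C := (\prod_(i < n | i != j) p k A i)%R.
have hS i : i != j -> h k.+1 A i = h k A i.
  by move=> ij; rewrite /h ltnS leq_eqVlt -[_ == k]/(i == j) (negbTE ij).
have pS i : i != j -> p k.+1 A i = p k A i.
  by move=> ij; rewrite /p ltnS leq_eqVlt -[_ == k]/(i == j) (negbTE ij).
have hj : h k.+1 A j = g j by rewrite /h ltnS leqnn.
have pj : p k.+1 A j = c j by rewrite /p ltnS leqnn.
transitivity (\int[P]_w (g j (Y j w) * G w)%:E).
  apply: eq_integral => w _; congr EFin; rewrite (bigD1 j)//= hj; congr (_ * _)%R.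
  by apply: eq_bigr => i ij; rewrite hS.
rewrite (@integral_comp_indep _ _ C)//.
- rewrite gc -EFinM (bigD1 j)//= pj mulrC; congr (_ * _)%:E.
  by apply: eq_bigr => i ij; rewrite pS.
- rewrite /G; under eq_fun do rewrite -big_filter.
  apply: measurable_prod => i _.
  by apply: measurableT_comp => //; exact: mh.
- by move=> w; apply: prodr_ge0.
- exact: prodr_ge0.
move=> B mB.
(* Putting an arbitrary [B] at index [j] makes the induction hypothesis the identity on indicators
   that [integral_comp_indep] requires. *)
pose A' i := if i == j then B else A i.
have mA' i : measurable (A' i) by rewrite /A'; case: ifP.
have hj' : h k A' j = \1_B by rewrite /h ltnn /A' eqxx.
have pj' : p k A' j = fine (P (Y j @^-1` B)) by rewrite /p ltnn /A' eqxx.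
have := IH (ltnW kn) A' mA'.
rewrite [in X in _ = X -> _](bigD1 j)//= pj' EFinM fineK; last first.
  by rewrite fin_num_measure//; exact: mYA.
rewrite muleC => HH.
rewrite [X in X * _](_ : _ = (\prod_(i < n | i != j) p k A' i)%:E); last first.
  by congr EFin; apply: eq_bigr => i ij; rewrite /p /A' (negbTE ij).
rewrite -HH; apply: eq_integral => w _; congr EFin.
rewrite [RHS](bigD1 j)//= hj'; congr (_ * _)%R.
by apply: eq_bigr => i ij; rewrite /h /A' (negbTE ij).
Qed.

End independence.

(** * The Cameron-Martin formula for ramps *)

Section normal_translation.
Local Open Scope ereal_scope.
Context {R : realType}.

Lemma lebesgue_measure_translation (a : R) (A : set R) : measurable A ->
  pushforward lebesgue_measure (+%R a : _ -> measurableTypeR R) A = lebesgue_measure A.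
Proof.
move=> mA.
have mtr : measurable_fun setT (+%R a : measurableTypeR R -> measurableTypeR R).
  exact: measurable_funD.
apply/esym/(@lebesgue_measure_unique R
  (pushforward_measure lebesgue_measure mtr)) => //= _ [[b c]] _ <-.
rewrite /pushforward/= (_ : +%R a @^-1` _ = `](b - a)%R, (c - a)%R]%classic); last first.
  apply/seteqP; split => x /=; rewrite !in_itv/= => /andP[xb xc]; apply/andP; split; lra.
rewrite !lebesgue_measure_itv/= !lte_fin ltrD2r; case: ifP => // _.
by rewrite -!EFinB opprB addrA subrK.
Qed.

(** The Cameron-Martin formula in dimension one: the exponential is the quotient of the Gaussian
    densities of means [a] and 0, and Lebesgue measure is translation invariant. *)
Lemma normal_prob_translation (s a : R) (A : set R) : s != 0%R -> measurable A ->
  normal_prob 0 s [set y | A (y + a)%R] =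
  \int[normal_prob 0 s]_y (\1_A y * expR (a / s ^+ 2 * y - a ^+ 2 / (s ^+ 2 *+ 2)))%:E.
Proof.
move=> s0 mA.
have mpdf (m : R) : measurable_fun setT (normal_pdf m s) by exact: measurable_normal_pdf.
have mtr : measurable_fun setT (+%R a : measurableTypeR R -> measurableTypeR R).
  exact: measurable_funD.
pose e y := expR (a / s ^+ 2 * y - a ^+ 2 / (s ^+ 2 *+ 2)).
have me : measurable_fun setT e.
  apply: measurableT_comp => //.
  by apply: measurable_funB => //; exact: measurable_funM.
transitivity (\int[lebesgue_measure]_y
    ((\1_A y * e y)%:E * (normal_pdf 0 s y)%:E)); last first.
  apply/esym/(@ge0_integral_density _ _ _ lebesgue_measure (normal_pdf 0 s)
    (mpdf 0%R) (normal_pdf_ge0 0 s)) => //.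
    by apply/measurable_EFinP/measurable_funM.
have mf : measurable_fun setT (fun y => (\1_A y * normal_pdf a s y)%:E).
  by apply/measurable_EFinP/measurable_funM.
transitivity (\int[lebesgue_measure]_y (\1_A y * normal_pdf a s y)%:E); last first.
  apply: eq_integral => y _; rewrite -EFinM -mulrA; congr (_ * _)%:E.
  rewrite !normal_pdfE// mulrCA; congr (_ * _)%R.
  rewrite /normal_fun -expRD; congr expR.
  by field.
transitivity (\int[pushforward_measure lebesgue_measure mtr]_y
    (\1_A y * normal_pdf a s y)%:E); last first.
  by apply: eq_measure_integral => B mB _; exact: (lebesgue_measure_translation a).
rewrite ge0_integral_pushforward//; last first.
  by move=> y _; rewrite lee_fin mulr_ge0// normal_pdf_ge0.
rewrite preimage_setT /normal_prob [LHS]integral_mkcond; apply: eq_integral => y _ /=.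
rewrite epatch_indic muleC -EFinM; congr (_ * _)%:E.
  rewrite !indicE; congr (nat_of_bool _)%:R.
  by apply/idP/idP => /set_mem h; apply/mem_set; move: h => /=; rewrite addrC.
by rewrite !normal_pdfE// /normal_fun subr0 addrC addKr.
Qed.

End normal_translation.

Section wiener.
Context {R : realType} (mu : probability (borel_C0 R) R).
Hypothesis wmu : wiener_measure mu.

Definition incr (s t : time R) (x : borel_C0 R) : R := (x : C0 R) t - (x : C0 R) s.

Lemma measurable_incr s t : measurable_fun setT (incr s t).
Proof. by apply: measurable_funB; exact: measurable_eval. Qed.

Lemma measurable_incr_preimage s t (A : set R) : measurable A ->
  measurable (incr s t @^-1` A).
Proof.
by move=> mA; rewrite -[X in measurable X]setTI; exact: measurable_incr.
Qed.

Lemma wiener_increment_law (s t : time R) (A : set R) : val s < val t ->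
  measurable A ->
  mu (incr s t @^-1` A) = normal_prob 0 (Num.sqrt (val t - val s)) A.
Proof.
move=> st mA; have [d [T [P [W [[_ _ _ law _] muE]]]]] := wmu.
by rewrite muE; [exact: law|exact: measurable_incr_preimage].
Qed.

Lemma wiener_independent_increments n (t : nat -> time R) :
  (forall i, (i < n)%N -> val (t i) <= val (t i.+1)) ->
  mutually_independent mu (fun i : 'I_n => incr (t i) (t i.+1)).
Proof.
move=> tle A mA; have [d [T [P [W [[_ _ _ _ ind] muE]]]]] := wmu.
have /(_ A mA) := ind n t tle.
rewrite muE.
  move=> h; apply: etrans h _; apply: eq_bigr => i _.
  by rewrite muE//; exact: measurable_incr_preimage.
rewrite (_ : [set w | _] = \bigcap_(i in [set: 'I_n]) (incr (t i) (t i.+1) @^-1` A i)).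
  by apply: fin_bigcap_measurable => // i _; exact: measurable_incr_preimage.
by apply/seteqP; split => w /= h' i; [move=> _|]; exact: h'.
Qed.

Lemma measurable_translation (c : C0 R) :
  measurable_fun setT (fun x : borel_C0 R => (x : C0 R) + c : borel_C0 R).
Proof.
apply: measurable_fun_C0 => t.
have -> : (fun w : borel_C0 R => ((w : C0 R) + c) t) =
    (fun w : borel_C0 R => (w : C0 R) t + c t) by [].
by apply: measurable_funD => //; exact: measurable_eval.
Qed.

Definition dyadic_rect n (A : 'I_(2 ^ n) -> set R) : set (borel_C0 R) :=
  [set x | forall i : 'I_(2 ^ n), A i (incr (dyad R n i) (dyad R n i.+1) x)].

Lemma dyadic_rectE n A : dyadic_rect n A =
  \bigcap_(i in [set: 'I_(2 ^ n)]) (incr (dyad R n i) (dyad R n i.+1) @^-1` A i).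
Proof.
by apply/seteqP; split => w /= h' i; [move=> _|]; exact: h'.
Qed.

Lemma measurable_dyadic_rect n A : (forall i, measurable (A i)) ->
  measurable (dyadic_rect n A).
Proof.
move=> mA; rewrite dyadic_rectE.
by apply: fin_bigcap_measurable => // i _; exact: measurable_incr_preimage.
Qed.

(** The density of the law of [x + c *: ramp R s] with respect to Wiener measure: the shift has
    derivative [c] on [[0, s]], whose Wiener integral is [c * x s] and whose squared norm is
    [c ^+ 2 * val s]. *)
Definition cm_density (s : time R) (c : R) (x : borel_C0 R) : R :=
  expR (c * (x : C0 R) s - c ^+ 2 * val s / 2).

Lemma measurable_cm_density s c : measurable_fun setT (cm_density s c).
Proof.
apply: measurableT_comp => //; apply: measurable_funB => //.
by apply: measurable_funM => //; exact: measurable_eval.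
Qed.

Lemma cm_density_ge0 s c x : 0 <= cm_density s c x.
Proof. exact: expR_ge0. Qed.

(** The shift adds [c * mesh R n] to the increments of the first [k] cells and 0 to the others. By
    independence both sides are products over the cells, equal factor by factor by
    [normal_prob_translation]. *)
Lemma cameron_martin_rect n k (c : R) A : (k <= 2 ^ n)%N ->
  (forall i, measurable (A i)) ->
  mu [set x | dyadic_rect n A ((x : C0 R) + c *: ramp R (dyad R n k))] =
  (\int[mu]_(x in dyadic_rect n A) (cm_density (dyad R n k) c x)%:E)%E.
Proof.
move=> kn mA.
pose dl := mesh R n; have dl0 : 0 < dl := mesh_gt0 R n.
pose sg := Num.sqrt dl; have sg0 : sg != 0 by rewrite gt_eqF// sqrtr_gt0.
have sg2 : sg ^+ 2 = dl by rewrite sqr_sqrtr// ltW.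
pose a (i : nat) : R := if (i < k)%N then c * dl else 0.
pose Y (i : nat) := incr (dyad R n i) (dyad R n i.+1).
have lawY (i : 'I_(2 ^ n)) B : measurable B -> mu (Y i @^-1` B) = normal_prob 0 sg B.
  move=> mB.
  have iN := ltn_ord i.
  have e1 := dyadE R n i (ltnW iN).
  have e2 := dyadE R n i.+1 iN.
  have e3 : val (dyad R n i) < val (dyad R n i.+1).
    by rewrite e1 e2 mulrS ltrDr.
  have := wiener_increment_law _ _ B e3 mB.
  by rewrite e1 e2 mulrS addrK.
have mtr (b : R) : measurable_fun setT (fun y : R => y + b) by exact: measurable_funD.
pose A' (i : 'I_(2 ^ n)) := [set y | A i (y + a i)].
have mA' i : measurable (A' i).
  by rewrite -[X in measurable X]setTI; exact: mtr.
have indY := wiener_independent_increments (2 ^ n) (dyad R n).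
have /indY{}indY : forall i, (i < 2 ^ n)%N -> val (dyad R n i) <= val (dyad R n i.+1).
  by move=> i iN; rewrite !dyadE// ?(ltnW iN)// mulrS lerDr ltW.
have Yshift (i : 'I_(2 ^ n)) (x : C0 R) :
    Y i (x + c *: ramp R (dyad R n k)) = Y i x + a i.
  have iN := ltn_ord i.
  have hr j : (j <= 2 ^ n)%N ->
      ramp R (dyad R n k) (dyad R n j) = dl *+ minn j k.
    move=> jN; rewrite rampE !dyadE//.
    have [jk|kj] := leqP j k.
      by rewrite min_l// -![mesh R n *+ _]mulr_natr ler_wpM2l ?(ltW dl0)// ler_nat.
    by rewrite min_r// -![mesh R n *+ _]mulr_natr ler_wpM2l ?(ltW dl0)// ler_nat ltnW.
  rewrite /Y /incr !C0_D !C0_Z !hr// ?(ltnW iN)//.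
  suff -> : a i = c * (dl *+ minn i.+1 k) - c * (dl *+ minn i k) by ring.
  rewrite -mulrBr /a; case: ltnP => ik.
    by rewrite (minn_idPl ik) mulrS addrK.
  by rewrite (minn_idPr (leqW ik)) subrr mulr0.
pose g (i : 'I_(2 ^ n)) (y : R) :=
  \1_(A i) y * expR (a i / sg ^+ 2 * y - a i ^+ 2 / (sg ^+ 2 *+ 2)).
have mg i : measurable_fun setT (g i).
  apply: measurable_funM => //; apply: measurableT_comp => //.
  by apply: measurable_funB => //; exact: measurable_funM.
have g0 i y : 0 <= g i y by rewrite mulr_ge0// expR_ge0.
have finN B : measurable B -> normal_prob 0 sg B \is a fin_num.
  by move=> mB; apply: fin_num_measure.
have gE i : (\int[mu]_x (g i (Y i x))%:E = (fine (normal_prob 0 sg (A' i)))%:E)%E.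
  rewrite fineK; last exact: (finN _ (mA' i)).
  rewrite normal_prob_translation//.
  have mY : measurable_fun setT (Y i : borel_C0 R -> measurableTypeR R).
    exact: measurable_incr.
  have mEg : measurable_fun setT (fun y : measurableTypeR R => (g i y)%:E).
    by apply/measurable_EFinP; exact: mg.
  transitivity (\int[pushforward_measure mu mY]_y (g i y)%:E)%E.
    by rewrite ge0_integral_pushforward// => y _; rewrite lee_fin.
  by apply: eq_measure_integral => B mB _; exact: lawY.
have := @integral_prod_independent _ _ R mu _ (fun i : 'I_(2 ^ n) => Y i) g
  _ _ mg g0 indY gE.
move=> /(_ (fun i => measurable_incr _ _)) prodE.
transitivity (\prod_(i < 2 ^ n) (normal_prob 0 sg (A' i)))%E.
  transitivity (mu [set x | forall i : 'I_(2 ^ n), A' i (Y i x)]).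
    congr (mu _); apply/seteqP; split => x h i; have := h i.
      by rewrite -/(Y i _) Yshift.
    by rewrite /A' /= -Yshift.
  by rewrite indY//; apply: eq_bigr => i _; exact: (lawY i _ (mA' i)).
transitivity (\prod_(i < 2 ^ n) (fine (normal_prob 0 sg (A' i))))%:E.
  by rewrite -prodEFin; apply: eq_bigr => i _; rewrite fineK//; exact: (finN _ (mA' i)).
rewrite -prodE [RHS]integral_mkcond; apply: eq_integral => x _.
rewrite epatch_indic muleC -EFinM; congr EFin.
rewrite /g big_split/=; congr (_ * _).
  rewrite indicE; case: (pselect (dyadic_rect n A x)) => hx.
    rewrite mem_set// big1// => i _.
    by rewrite indicE mem_set//; exact: hx.
  rewrite memNset//; move: hx => /existsNP[i nA].
  by rewrite (bigD1 i)//= indicE memNset// mul0r.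
rewrite -expR_sum; congr expR.
(* Since [a i] is [c] times the variance for [i < k], each exponent is [c * Y i x] minus a constant,
   and the increments telescope to the value at node [k]. *)
rewrite (eq_bigr (fun i : 'I_(2 ^ n) =>
  if (i < k)%N then c * Y i x - c ^+ 2 * dl / 2 else 0)); last first.
  move=> i _; rewrite /a sg2; case: ifP => _; last first.
    by rewrite !mul0r expr0n/= !mul0r subrr.
  by field; rewrite gt_eqF.
rewrite -big_mkcond/= -(big_ord_widen _ (fun i => c * Y i x - c ^+ 2 * dl / 2) kn).
rewrite big_split/= -mulr_sumr sumr_const card_ord -(big_mkord xpredT (fun i => Y i x)).
rewrite /Y /incr telescope_sumr// dyad0 C0_at0 subr0 (minn_idPl kn).
by rewrite mulNrn mulrnAr mulrnAl.
Qed.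

End wiener.

Section path_space.
Context {R : realType} (mu : probability (borel_C0 R) R).
Hypothesis wmu : wiener_measure mu.

Definition dyadic_rects n : set (set (borel_C0 R)) :=
  [set B | exists2 A, (forall i, measurable (A i)) & B = dyadic_rect n A].

Lemma dyadic_rects_setI n : setI_closed (dyadic_rects n).
Proof.
move=> _ _ [A mA ->] [B mB ->].
exists (fun i => A i `&` B i); first by move=> i; exact: measurableI.
apply/seteqP; split => x /=.
  by move=> [hA hB] i; split; [exact: hA|exact: hB].
by move=> h; split => i; have [] := h i.
Qed.

Lemma dyadic_rects_setT n : dyadic_rects n setT.
Proof. by exists (fun=> setT) => //; apply/seteqP; split. Qed.

(** The value at node [k] is the sum of the first [k] increments, as paths start at 0. *)
Lemma dyadic_evals_sub_rects n : dyadic_evals R n `<=` <<s dyadic_rects n >>.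
Proof.
move=> _ [k [B [mB ->]]].
wlog kn : k / (k <= 2 ^ n)%N => [wl|].
  have := wl (minn k (2 ^ n)) (geq_minr _ _).
  suff -> : dyad R n (minn k (2 ^ n)) = dyad R n k by [].
  by apply: val_inj; rewrite /= -minnA minnn.
pose T := g_sigma_algebraType (dyadic_rects n).
have mi (i : nat) : (i < 2 ^ n)%N ->
    measurable_fun [set: T] (incr (dyad R n i) (dyad R n i.+1)).
  move=> iN _ D mD; rewrite setTI; apply: sub_sigma_algebra.
  exists (fun j : 'I_(2 ^ n) => if j == Ordinal iN then D else setT).
    by move=> j; case: ifP.
  apply/seteqP; split => x /=.
    by move=> Dx j; case: eqVneq => // ->.
  by move=> /(_ (Ordinal iN)); rewrite eqxx.
suff : measurable_fun [set: T] (fun x : C0 R => x (dyad R n k)).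
  by move=> /(_ measurableT B mB); rewrite setTI.
rewrite (_ : (fun _ => _) = fun x =>
  \sum_(0 <= i < k) incr (dyad R n i) (dyad R n i.+1) x); last first.
  by apply/funext => x; rewrite /incr telescope_sumr// dyad0 C0_at0 subr0.
under eq_fun do rewrite big_mkord.
apply: measurable_sum => i; apply: mi.
exact: leq_trans (ltn_ord i) kn.
Qed.

Lemma dyadic_evals_nested m n : (m <= n)%N -> dyadic_evals R m `<=` dyadic_evals R n.
Proof.
move=> mn _ [k [B [mB ->]]].
exists (minn k (2 ^ m) * 2 ^ (n - m))%N, B; split => //.
rewrite -dyad_refine//; last exact: geq_minr.
suff -> : dyad R m (minn k (2 ^ m)) = dyad R m k by [].
by apply: val_inj; rewrite /= -minnA minnn.
Qed.

(** Uniqueness of measures is used twice. Rectangles of one level are stable under intersection and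
    settle that level; rectangles of different levels need not intersect in a rectangle, so the
    union of the levels takes a second pass. *)
Lemma cameron_martin n k (c : R) (A : set (borel_C0 R)) : (k <= 2 ^ n)%N ->
  measurable A ->
  mu [set x | A ((x : C0 R) + c *: ramp R (dyad R n k))] =
  (\int[mu]_(x in A) (cm_density (dyad R n k) c x)%:E)%E.
Proof.
move=> kn mA.
pose m1 := pushforward_measure mu (measurable_translation (c *: ramp R (dyad R n k))).
pose m2 : {measure set borel_C0 R -> \bar R} :=
  density_measure mu (measurable_cm_density (dyad R n k) c)
    (cm_density_ge0 (dyad R n k) c).
rewrite -[LHS]/(m1 A) -[RHS]/(m2 A).
have m1T : (m1 setT < +oo)%E.
  by rewrite /m1 [X in (X < _)%E](_ : _ = mu setT)// probability_setT ltry.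
(* At a level [m >= n] the node of the ramp is again a node, so [cameron_martin_rect] applies. *)
have rects_eq m : (n <= m)%N -> forall B, <<s dyadic_rects m >> B -> m1 B = m2 B.
  move=> nm; apply: (g_sigma_algebra_measure_unique (dyadic_rects m) _ (fun=> setT)) => //.
  - by move=> _ [B mB ->]; exact: measurable_dyadic_rect.
  - by move=> _; exact: dyadic_rects_setT.
  - by apply/seteqP; split => // x _; exists 0%N.
  - exact: dyadic_rects_setI.
  move=> _ [B mB ->]; rewrite /m1 /m2.
  have km : (k * 2 ^ (m - n) <= 2 ^ m)%N.
    by rewrite -[X in (_ <= 2 ^ X)%N](subnKC nm) expnD leq_mul2r kn orbT.
  have := cameron_martin_rect _ wmu m (k * 2 ^ (m - n)) c B km mB.
  by rewrite -(dyad_refine R n m k nm kn).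
(* The sigma-algebras of dyadic evaluations increase with the level, so their
   union is stable under intersection. *)
pose G : set (set (borel_C0 R)) := \bigcup_m <<s dyadic_evals R (n + m) >>.
have evals_rects m : <<s dyadic_evals R m >> `<=` <<s dyadic_rects m >>.
  apply: smallest_sub; first exact: smallest_sigma_algebra.
  exact: dyadic_evals_sub_rects.
have evals_mon l m : (l <= m)%N -> <<s dyadic_evals R l >> `<=` <<s dyadic_evals R m >>.
  by move=> lm; apply: sub_sigma_algebra2; exact: dyadic_evals_nested.
have evals_measurable m : <<s dyadic_evals R m >> `<=` @measurable _ (borel_C0 R).
  rewrite borel_C0_dyadic; by apply: sub_sigma_algebra2 => B hB; exists m.
have GT : G setT.
  exists 0%N => //; exact: (@measurableT _ (g_sigma_algebraType (dyadic_evals R (n + 0)))).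
have G_eq : forall B, <<s G >> B -> m1 B = m2 B.
  apply: (g_sigma_algebra_measure_unique G _ (fun=> setT)) => //.
  - by move=> B [m _ /evals_measurable].
  - by apply/seteqP; split => // x _; exists 0%N.
  - move=> B1 B2 [m _ h1] [l _ h2].
    exists (maxn m l) => //.
    apply: (@measurableI _ (g_sigma_algebraType (dyadic_evals R (n + maxn m l)))).
      by apply: evals_mon h1; rewrite leq_add2l leq_maxl.
    by apply: evals_mon h2; rewrite leq_add2l leq_maxr.
  move=> B [m _ hB]; apply: (rects_eq (n + m)%N); first exact: leq_addr.
  exact: evals_rects.
(* Evaluations of any level [m] are among those of level [n + m], so [G] still generates all Borel
   sets. *)
apply: G_eq; move: A mA; rewrite borel_C0_dyadic.
apply: smallest_sub; first exact: smallest_sigma_algebra.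
move=> B [m _ hB]; apply: sub_sigma_algebra; exists m => //.
apply: (evals_mon m); first exact: leq_addl.
exact: sub_sigma_algebra.
Qed.

(** * Quasi-invariance and sets that are null along lines *)

Lemma quasi_invariance_ramp n k (c : R) (A : set (borel_C0 R)) : (k <= 2 ^ n)%N ->
  measurable A -> mu A = 0%E ->
  mu [set x | A ((x : C0 R) + c *: ramp R (dyad R n k))] = 0%E.
Proof.
move=> kn mA A0; rewrite cameron_martin//.
apply: null_set_integral => //.
by apply: measurable_funTS; apply/measurable_EFinP; exact: measurable_cm_density.
Qed.

Lemma measurable_translate (A : set (borel_C0 R)) (c : C0 R) : measurable A ->
  measurable [set x : borel_C0 R | A ((x : C0 R) + c)].
Proof.
by move=> mA; rewrite -[X in measurable X]setTI; exact: measurable_translation.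
Qed.

(** One ramp at a time: the set is first translated by the remaining ramps, which keeps it null by
    induction. *)
Lemma quasi_invariance l (t : R) (A : set (borel_C0 R)) :
  measurable A -> mu A = 0%E ->
  mu [set x | A ((x : C0 R) + t *: ramp_comb R l)] = 0%E.
Proof.
elim: l A => [|[[n k] q] l IH] A mA A0.
  rewrite /ramp_comb big_nil scaler0; under eq_set do rewrite addr0.
  exact: A0.
pose A' := [set x : borel_C0 R | A ((x : C0 R) + t *: ramp_comb R l)].
have mA' : measurable A' by exact: measurable_translate.
(* The clamped index names the same node and meets the bound [2 ^ n]. *)
have -> : [set x : borel_C0 R | A ((x : C0 R) + t *: ramp_comb R ((n, k, q) :: l))] =
    [set x | A' ((x : C0 R) + (t * ratr q) *: ramp R (dyad R n (minn k (2 ^ n))))].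
  apply: eq_set => x; rewrite /A' /= /ramp_comb big_cons/= scalerDr scalerA addrA.
  by congr (A (_ + _ *: ramp R _ + _)); apply: val_inj; rewrite /= -minnA minnn.
by apply: quasi_invariance_ramp => //; [exact: geq_minr|exact: IH].
Qed.

Lemma null_of_null_on_lines l (A : set (borel_C0 R)) : measurable A ->
  (forall x : C0 R, countable [set t : R | A (x + t *: ramp_comb R l)]) ->
  mu A = 0%E.
Proof.
move=> mA Acount; set c := ramp_comb R l in Acount *.
pose F (z : borel_C0 R * measurableTypeR R) : borel_C0 R := (z.1 : C0 R) + z.2 *: c.
have mF : measurable_fun setT F.
  apply: measurable_fun_C0 => t.
  have -> : (fun w => (F w : C0 R) t) = (fun w => (w.1 : C0 R) t + w.2 * c t) by [].
  apply: measurable_funD; last by apply: measurable_funM => //; exact: measurable_snd.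
  by apply: (measurableT_comp (measurable_eval R t)); exact: measurable_fst.
have mFA : measurable (F @^-1` A) by rewrite -[X in measurable X]setTI; exact: mF.
have := indic_fubini_tonelli mu lebesgue_measure mFA.
rewrite indic_fubini_tonelli_FE// indic_fubini_tonelli_GE//.
rewrite [LHS](_ : _ = 0%E); last first.
  apply: integral0_eq => x _ /=.
  rewrite (_ : xsection _ _ = [set t : R | A ((x : C0 R) + t *: c)]).
    exact: countable_lebesgue_measure0.
  by apply/seteqP; split => t /=; rewrite /xsection/= inE.
move=> /esym I0.
have mG : measurable_fun setT (mu \o ysection (F @^-1` A)) by exact: measurable_fun_ysection.
have [B [mB B0 GB]] : ae_eq lebesgue_measure setT (mu \o ysection (F @^-1` A)) (cst 0%E).
  apply/ae_eq_integral_abs => //; rewrite -[RHS]I0.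
  by apply: eq_integral => t _; rewrite gee0_abs.
have [t0 At0] : exists t, mu [set x : borel_C0 R | A ((x : C0 R) + t *: c)] = 0%E.
  (* Otherwise the exceptional null set would be the whole line, which contains [[0, 1]] of measure
     1. *)
  apply: contrapT => /forallNP noT.
  have BT : B = setT.
    apply/seteqP; split => // t _; apply: GB => /= /(_ I) h; apply: (noT t).
    rewrite -[RHS]h; congr (mu _).
    by apply/seteqP; split => x /=; rewrite /ysection/= inE.
  have : (lebesgue_measure `[0%R : R, 1%R] <= lebesgue_measure B)%E.
    by apply: le_measure; rewrite ?inE// BT.
  by rewrite B0 lebesgue_measure_itv/= lte01 oppr0 adde0 leNgt lte01.
have mA' : measurable [set x : borel_C0 R | A ((x : C0 R) + t0 *: c)].
  exact: measurable_translate.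
have := quasi_invariance l (- t0) _ mA' At0.
move=> <-; congr (mu _).
by apply/seteqP; split => x /=; rewrite scaleNr subrK.
Qed.

End path_space.

(** * Covering the zero set by countably many null sets *)

Lemma negligible_bigcup_countType d (T : measurableType d) (R : realType)
    (mu : {measure set T -> \bar R}) (I : countType) (F : I -> set T) :
  (forall i, mu.-negligible (F i)) -> mu.-negligible (\bigcup_i F i).
Proof.
move=> F0; pose G n := if unpickle n is Some i then F i else set0.
have -> : \bigcup_i F i = \bigcup_n G n.
  apply/seteqP; split => x; rewrite /G.
    by move=> [i _ Fi]; exists (pickle i) => //; rewrite pickleK.
  by move=> [n _]; case: unpickle => // i Fi; exists i.
apply: negligible_bigcup => n; rewrite /G.
by case: unpickle => [i|]; [exact: F0|exact: negligible_set0].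
Qed.

Theorem theorem3p1 (R : realType) (mu : probability (borel_C0 R) R)
    (f : C0 R -> R) :
  wiener_measure mu ->
  continuous f -> locally_analytic f -> (exists B, f B <> 0) ->
  mu [set B | f B = 0] = 0%E.
Proof.
move=> wmu cf fa [B0 fB0].
have mf : measurable_fun setT (f : borel_C0 R -> R) by exact: measurable_continuous_C0.
have mf_pre (D : set R) : measurable D -> measurable (f @^-1` D : set (borel_C0 R)).
  by move=> mD; rewrite -[X in measurable X]setTI; exact: mf.
pose Z : set (borel_C0 R) := [set x | f x = 0].
have mZ : measurable Z by exact: (mf_pre [set 0]).
pose A l : set (borel_C0 R) := Z `&` [set x | f ((x : C0 R) + ramp_comb R l) <> 0].
have mA l : measurable (A l).
  apply: measurableI => //.
  exact: (measurable_translate (~` Z) (ramp_comb R l) (measurableC mZ)).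
have A0 l : mu (A l) = 0%E.
  apply: (null_of_null_on_lines mu wmu l) => // x.
  have [[t ft]|no] := pselect (exists t : R, f (x + t *: ramp_comb R l) <> 0).
    apply: sub_countable
      (countable_zeros_line R (C0 R) f x (ramp_comb R l) fa (ex_intro _ t ft)).
    by apply: subset_card_le => s [].
  (* When [f] vanishes along the whole line, [A l] misses it: membership at [t] would give a nonzero
     value at [t + 1]. *)
  rewrite (_ : [set t | _] = set0); first exact: countable0.
  apply/seteqP; split => // t [_ ft]; apply: no; exists (t + 1).
  by rewrite scalerDl scale1r addrA.
have ZA : Z `<=` \bigcup_l A l.
  move=> x fx.
  have oU : open [set y : C0 R | f y != 0].
    by move/continuousP : cf => /(_ _ (@open_neq R 0)).
  have [e e0 He] := @open_ball_sub R (C0 R) _ B0 oU (introN eqP fB0).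
  (* Approximating [B0 - x] brings [x + ramp_comb R l] close enough to [B0] for [f] to be nonzero
     there. *)
  have [l xl] := ramp_comb_dense R (B0 - x) _ e0.
  have /He/eqP fxl : `|B0 - (x + ramp_comb R l)| < e by rewrite opprD addrA.
  by exists l.
apply/negligibleP => //; apply: negligibleS ZA _.
apply: negligible_bigcup_countType => l.
by apply/(negligibleP _ (mA l)); exact: A0.
Qed.
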